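(* Let $n\geq1$ be an integer. Let $W$ be a random variable with zero mean and finite, non-zero variance $\sigma^2$, and let $W^{\square}$ have the $W$-square bias distribution. Let $U_1,\ldots,U_n$ be independent $U(0,1)$ random variables, which are independent of $W^{\square}$. Define $V_n=\prod_{k=1}^nU_k$. Then the random variable $$W^{*(n)}\stackrel{\mathcal{D}}{=}V_nW^{\square}$$ has the $W$-zero bias distribution of order $n$.
   Context: For a random variable $W$ with finite (non-zero) second moment, $W^{\square}$ has the $W$-square bias distribution if $\mathbb{E}W^2f(W)=\mathbb{E}W^2\,\mathbb{E}f(W^{\square})$ for all $f$ such that $\mathbb{E}W^2f(W)$ exists. For $W$ of mean zero and finite, non-zero variance $\sigma^2$, $W^{*(n)}$ has the $W$-zero bias(ed) distribution of order $n$ if for all $n$ times differentiable $f$ for which $\mathbb{E}Wf(W)$ exists (and the right-hand expectation makes sense), $\mathbb{E}Wf(W)=\sigma^2\mathbb{E}A_nf(W^{*(n)})$, where $A_nf(x)=x^{-1}T^nf(x)=\frac{\mathrm{d}}{\mathrm{d}x}(T^{n-1}f(x))$ and $Tf(x)=xf'(x)$; this distribution exists and is unique. $\stackrel{\mathcal{D}}{=}$ is equality in distribution. *)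

(* Defs.v *)
From mathcomp Require Import all_boot all_order all_algebra.
From mathcomp Require Import all_classical all_reals all_analysis.

Set Implicit Arguments.
Unset Strict Implicit.
Unset Printing Implicit Defensive.

Import Order.TTheory GRing.Theory Num.Theory.
Import numFieldNormedType.Exports.

Local Open Scope classical_set_scope.
Local Open Scope ring_scope.

(* Laws are compared on measurable sets only: measures are functions defined on
   all sets, and their values on non-measurable sets carry no meaning. *)
Definition same_law d (T : measurableType d) (R : realType)
    (mu nu : set T -> \bar R) : Prop :=
  forall A : set T, measurable A -> mu A = nu A.

Definition eq_in_law d1 (T1 : measurableType d1) d2 (T2 : measurableType d2)
    d (S : measurableType d) (R : realType)
    (P1 : probability T1 R) (X : T1 -> S) (P2 : probability T2 R) (Y : T2 -> S)
    : Prop :=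
  same_law (pushforward P1 X) (pushforward P2 Y).

Definition mutually_independent d (T : measurableType d) (R : realType)
    (P : probability T R) (I : finType) d' (S : measurableType d')
    (X : I -> T -> S) : Prop :=
  forall (J : {set I}) (B : I -> set S), (forall i, measurable (B i)) ->
    P (\bigcap_(i in [set` J]) X i @^-1` B i) =
    (\prod_(i in J) P (X i @^-1` B i))%E.

Definition independent2 d (T : measurableType d) (R : realType)
    (P : probability T R) d1 (S1 : measurableType d1) d2 (S2 : measurableType d2)
    (X : T -> S1) (Y : T -> S2) : Prop :=
  forall (A : set S1) (B : set S2), measurable A -> measurable B ->
    P (X @^-1` A `&` Y @^-1` B) = (P (X @^-1` A) * P (Y @^-1` B))%E.

(* If the left-hand side is finite and E W^2 > 0, the equality forces f(W') to
   be integrable. *)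
Definition square_biased (R : realType)
    d (T : measurableType d) (P : probability T R) (W : T -> R)
    d' (T' : measurableType d') (Q : probability T' R) (W' : T' -> R) : Prop :=
  forall f : R -> R, measurable_fun setT f ->
    P.-integrable setT (fun t => (W t ^+ 2 * f (W t))%:E) ->
    ('E_P[(fun t => W t ^+ 2 * f (W t))%R] =
     'E_P[(fun t => W t ^+ 2)%R] * 'E_Q[(fun t => f (W' t))%R])%E.

Definition n_times_derivable (R : realType) (n : nat) (f : R -> R) : Prop :=
  forall k : nat, (k < n)%N -> forall x : R, derivable (derive1n k f) x 1.

Definition T_op (R : realType) (f : R -> R) : R -> R := fun x => x * derive1 f x.

(* A_n for n >= 1, as the derivative of T^(n-1) f, which also gives it its value
   at 0. *)
Definition A_op (R : realType) (n : nat) (f : R -> R) : R -> R :=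
  derive1 (iter n.-1 (@T_op R) f).

Lemma A_opE (R : realType) (n : nat) (f : R -> R) (x : R) :
  (0 < n)%N -> x != 0 -> A_op n f x = x^-1 * iter n (@T_op R) f x.
Proof. by case: n => // n _ x0; rewrite /A_op /T_op /= mulKf. Qed.

Definition zero_biased (R : realType) (n : nat)
    d (T : measurableType d) (P : probability T R) (W : T -> R)
    d' (T' : measurableType d') (Q : probability T' R) (W' : T' -> R) : Prop :=
  forall f : R -> R, n_times_derivable n f ->
    P.-integrable setT (fun t => (W t * f (W t))%:E) ->
    Q.-integrable setT (fun t => (A_op n f (W' t))%:E) ->
    ('E_P[(fun t => W t * f (W t))%R] =
     'V_P[W] * 'E_Q[(fun t => A_op n f (W' t))%R])%E.

(* Main.v *)
From HB Require Import structures.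
Require Import Defs.
From mathcomp Require Import all_boot all_order all_algebra.
From mathcomp Require Import all_classical all_reals all_analysis.
From mathcomp Require Import measurable_realfun lra.
Import Order.TTheory GRing.Theory Num.Theory.
Import numFieldNormedType.Exports.

Set Implicit Arguments.
Unset Strict Implicit.
Unset Printing Implicit Defensive.

Local Open Scope classical_set_scope.
Local Open Scope ring_scope.

(** Write G_k = T^k f, so that A_n f is the derivative of G_(n-1), and
    X_k = U_1 ... U_k W^sq.

    The idea is to average out the uniform factors one at a time.  For a
    uniform U and a fixed x <> 0, the fundamental theorem of calculus gives
    E G'(U x) = (G(x) - G(0)) / x, the slope of G from the origin to x.  For
    G = G_(k+1) = T G_k this slope is G_k'(x), because T G_k (x) = x G_k'(x)
    vanishes at 0.  Since X_(k+1) is the product of X_k and an independent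
    uniform factor, conditioning on X_k turns E G_(n-1)'(X_n) into
    E G_(n-2)'(X_(n-1)), and so on down to E (f(W^sq) - f(0)) / W^sq
    ([integral_uniform_mul], [integral_derive1_iter_T_op]).  The square bias
    identity for the test function (f(x) - f(0)) / x rewrites this, up to the
    factor E W^2 = Var W, as E W (f(W) - f(0)), which is E W f(W) because W
    has mean zero ([square_biased_slope0]).

    The hypotheses make f differentiable n times but say nothing about the
    continuity of the n-th derivative, and only E |A_n f(X_n)| is finite.
    Fubini's theorem converts this into integrability of u |-> G'(u x) for
    almost every x, so the fundamental theorem is required in its sharp form:
    if G is differentiable at every point and G' is Lebesgue integrable, then
    the integral of G' is the increment of G ([integral_derive1]).  It follows
    from the Vitali-Caratheodory theorem: G' has a lower semicontinuous
    majorant v with nearly the same integral, and G increases at each point at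
    most as fast as the indefinite integral of v.

    That X_k and the next uniform factor are independent is a pi-lambda
    argument, by induction on k, from the independence of the U_i among
    themselves and from W^sq ([independent2_partial_prod]). *)

(** * Lower semicontinuous majorants *)

(** The layers {y | k e <= y} staircase the identity from above with step e:
    their weighted count at x exceeds x, but by at most e. *)
Lemma nneseries_truncn (R : realType) (e x : R) : 0 < e -> 0 <= x ->
  (\sum_(k <oo) (e * \1_[set y : R | k%:R * e <= y] x)%:E =
   (e * (Num.truncn (x / e)).+1%:R)%:E)%E.
Proof.
move=> e0 x0; set m := Num.truncn (x / e).
have xe0 : 0 <= x / e by rewrite divr_ge0// ltW.
have kx k : ([set y : R | k%:R * e <= y] x) <-> (k < m.+1)%N.
  by rewrite /= -ler_pdivlMr// ltnS truncn_ge_nat.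
rewrite (@nneseries_split _ _ 0%N m.+1)//=; last first.
  by move=> k _; rewrite lee_fin mulr_ge0// ltW.
rewrite add0n [X in (_ + X)%E]eseries0 ?adde0; last first.
  move=> k mk _; rewrite indicE memNset ?mulr0//.
  by rewrite kx; apply/negP; rewrite -leqNgt.
rewrite big_mkord sumEFin (eq_bigr (fun=> e)); last first.
  by move=> k _; rewrite indicE mem_set ?mulr1//; apply/kx.
by rewrite sumr_const card_ord mulr_natr.
Qed.

(** Each of the countably many level sets {phi >= k e} is enlarged to an open
    set at a small cost in measure; the weighted sum of the indicators of the
    open sets is lower semicontinuous, and the costs are summable. *)
Lemma vitali_caratheodory (R : realType) (A : set R) (phi : R -> R) (eta : R) :
  measurable A -> (lebesgue_measure A < +oo)%E ->
  measurable_fun A phi -> (forall x, A x -> 0 <= phi x) -> 0 < eta ->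
  exists v : R -> \bar R,
    [/\ forall x, (0 <= v x)%E, lower_semicontinuous v,
        forall x, A x -> ((phi x)%:E < v x)%E &
        (\int[lebesgue_measure]_(x in A) v x <=
         \int[lebesgue_measure]_(x in A) (phi x)%:E + eta%:E)%E].
Proof.
move=> mA Afin mphi phi0 eta0.
pose mu : measure _ _ := @lebesgue_measure R.
have muA0 : 0 <= fine (mu A) by rewrite fine_ge0.
(* Half of eta pays for the discretization, which costs e on all of A; the
   other half is shared among the open enlargements. *)
pose e := eta / 2 / (fine (mu A) + 1).
have e0 : 0 < e by rewrite /e !divr_gt0// ltr_wpDl.
pose E k := A `&` phi @^-1` [set y | k%:R * e <= y].
have mE k : measurable (E k).
  by apply: mphi => //; rewrite -set_itvcy; exact: measurable_itv.
have Efin k : (mu (E k) < +oo)%E.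
  apply: le_lt_trans Afin; apply: le_measure; last exact: subIsetl.
    by apply/mem_set; exact: mE.
  by apply/mem_set; exact: mA.
pose d k := eta / 2 / (2 ^ k.+1)%:R.
have d0 k : 0 < d k by rewrite !divr_gt0// ltr0n expn_gt0.
have /choice[G hG] : forall k, exists G : set R,
    [/\ open G, E k `<=` G & (mu (G `\` E k) < (d k / e)%:E)%E].
  by move=> k; apply: lebesgue_regularity_outer => //; rewrite divr_gt0.
have oG k : open (G k) by have [] := hG k.
have mG k : measurable (G k) by exact: open_measurable.
have EG k : E k `<=` G k by have [] := hG k.
pose t k x : \bar R := (e * \1_(G k) x)%:E.
have t0 k x : (0 <= t k x)%E by rewrite lee_fin mulr_ge0// ltW.
have mt k : measurable_fun A (t k).
  by apply/measurable_EFinP; apply: measurable_funM => //; exact: measurable_indic.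
exists (fun x => \sum_(k <oo) t k x)%E; split.
- by move=> x; exact: nneseries_ge0.
- move=> x a ax.
  (* A partial sum already exceeds a at x, and each of its finitely many terms
     can only grow near x. *)
  have [n nx] : exists n, (a%:E < \sum_(0 <= k < n) t k x)%E.
    apply: contrapT => /forallNP h; move: ax; apply/negP; rewrite -leNgt.
    apply: lime_le; first exact: is_cvg_nneseries.
    by near=> n; rewrite leNgt; apply/negP/h.
  have tG k : \forall y \near x, (t k x <= t k y)%E.
    have [Gkx|nGkx] := pselect (G k x); last first.
      by near=> y; rewrite /t [X in (e * X)%:E]indicE memNset// mulr0 t0.
    apply: filterS (open_nbhs_nbhs (conj (oG k) Gkx)) => y Gky.
    by rewrite /t !indicE !mem_set.
  exists [set y | (\sum_(0 <= k < n) t k x <= \sum_(0 <= k < n) t k y)%E].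
    elim: n {nx} => [|n IH]; first by near=> y; rewrite /= !big_geq.
    near=> y => /=; rewrite !big_nat_recr//= leeD//.
    + by near: y.
    + by near: y; exact: tG.
  move=> y /= xy; apply: (lt_le_trans (lt_le_trans nx xy)).
  exact: nneseries_lim_ge.
- move=> x Ax; apply: (@lt_le_trans _ _ (e * (Num.truncn (phi x / e)).+1%:R)%:E).
    rewrite lte_fin mulrC -ltr_pdivrMr//.
    by have /andP[] := truncn_itv (divr_ge0 (phi0 _ Ax) (ltW e0)).
  rewrite -nneseries_truncn//; last exact: phi0.
  apply: lee_nneseries => k _; first by rewrite lee_fin mulr_ge0// ltW.
  rewrite lee_fin ler_pM2l// !indicE.
  case: (boolP (_ \in _)) => // /set_mem kx.
  by rewrite mem_set//; apply: EG.
- rewrite integral_nneseries//.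
  have te_ge0 k x : (0 <= (e * \1_[set y : R | (k%:R * e <= y)%R] (phi x))%:E)%E.
    by rewrite lee_fin mulr_ge0// ltW.
  have mte k : measurable_fun A
      (fun x => (e * \1_[set y : R | (k%:R * e <= y)%R] (phi x))%:E).
    apply/measurable_EFinP; apply: measurable_funM => //.
    apply: (measurableT_comp _ mphi); apply: measurable_indic.
    by rewrite -set_itvcy; exact: measurable_itv.
  have step k : (\int[mu]_(x in A) t k x <=
      \int[mu]_(x in A) (e * \1_[set y : R | (k%:R * e <= y)%R] (phi x))%:E + (d k)%:E)%E.
    have -> : (\int[mu]_(x in A) t k x = e%:E * mu (G k `&` A))%E.
      under eq_integral do rewrite /t EFinM.
      rewrite ge0_integralZl_EFin ?integral_indic//; [exact: mG| |exact: ltW].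
      by apply/measurable_EFinP/measurable_indic; exact: mG.
    have -> : (\int[mu]_(x in A) (e * \1_[set y : R | (k%:R * e <= y)%R] (phi x))%:E =
               e%:E * mu (E k))%E.
      transitivity (\int[mu]_(x in A) (e%:E * (\1_(E k) x)%:E))%E.
        apply: eq_integral => x /set_mem Ax; rewrite -EFinM !indicE; congr (_ * _%:R)%:E.
        by congr nat_of_bool; apply/idP/idP => /set_mem h; apply/mem_set => //; case: h.
      rewrite ge0_integralZl_EFin ?integral_indic//; [|exact: mE| |exact: ltW].
        by rewrite setIidl//; exact: subIsetl.
      by apply/measurable_EFinP/measurable_indic; exact: mE.
    apply: (@le_trans _ _ (e%:E * (mu (E k) + (d k / e)%:E))%E).
      rewrite lee_pmul2l ?fin_numE// ?lte_fin//.
      apply: (@le_trans _ _ (mu (G k))).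
        by apply: measureIl; [exact: mG|exact: mA].
      rewrite (measureDI mu (mG k) (mE k)) addeC leeD//; last by case: (hG k) => _ _ /ltW.
      by apply: measureIr; [exact: mG|exact: mE].
    rewrite ge0_muleDr//; last by rewrite lee_fin divr_ge0// ltW.
    by rewrite -EFinM mulrCA divff ?mulr1// gt_eqF.
  apply: (le_trans (lee_nneseries _ (fun k _ => step k))) => //.
    by move=> k _ _; apply: integral_ge0 => x _; exact: t0.
  apply: (le_trans (epsilon_trick _ _ _)).
  - by move=> k; apply: integral_ge0 => x _; exact: te_ge0.
  - by rewrite divr_ge0// ltW.
  rewrite -integral_nneseries//.
  apply: (@le_trans _ _ (\int[mu]_(x in A) ((phi x)%:E + e%:E) + (eta / 2)%:E)%E).
    rewrite leeD2r//; apply: ge0_le_integral => //.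
    - by move=> x _; apply: nneseries_ge0.
    - by apply: ge0_emeasurable_sum => [k x Ax _|k _]; [exact: te_ge0|exact: mte].
    - by apply: emeasurable_funD => //; exact/measurable_EFinP.
    - move=> x Ax; rewrite nneseries_truncn//; last exact: phi0.
      rewrite -EFinD lee_fin -natr1 mulrDr mulr1 lerD2r mulrC -ler_pdivlMr//.
      by have /andP[] := truncn_itv (divr_ge0 (phi0 _ Ax) (ltW e0)).
  rewrite ge0_integralD//; [|exact/measurable_EFinP|by move=> x _; rewrite lee_fin ltW].
  rewrite integral_cst// -addeA leeD2l// -(@fineK _ (mu A)) ?ge0_fin_numE//.
  rewrite -EFinM -EFinD lee_fin [leRHS]splitr lerD2r /e mulrAC -mulrA ler_piMr//.
    by rewrite divr_ge0// ltW.
  by rewrite ler_pdivrMr ?mul1r ?lerDl// ltr_wpDl.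
Unshelve. all: by end_near.
Qed.

(** * Increments bounded by integrals of majorants of the derivative *)

(** No continuity is assumed: the supremum of the points reached from [a]
    without decrease is itself such a point by the left-hand condition, and
    the right-hand one leads past it unless it is [b]. *)
Lemma locally_increasing_le (R : realType) (h : R -> R) (a b : R) : a <= b ->
  (forall x, a <= x <= b -> exists2 d, 0 < d & forall y, a <= y <= b ->
    (x < y < x + d -> h x <= h y) /\ (x - d < y < x -> h y <= h x)) ->
  h a <= h b.
Proof.
move=> ab hloc; pose S := [set x | a <= x <= b /\ h a <= h x].
have Sa : S a by split; rewrite ?lexx.
have Sb : ubound S b by move=> x [/andP[]].
have hS : has_sup S by split; [exists a|exists b].
pose s := sup S.
have as_ : a <= s by apply: ub_le_sup; [exists b|].
have sb : s <= b by apply: ge_sup; [exists a|].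
have sab : a <= s <= b by rewrite as_ sb.
have [d d0 hd] := hloc s sab.
have Ss : h a <= h s.
  have [y [yab hay] sy] := sup_adherent d0 hS.
  have : y <= s by apply: ub_le_sup; [exists b|].
  rewrite le_eqVlt => /predU1P[<-//|ys].
  by apply: (le_trans hay); apply: (hd _ yab).2; rewrite sy.
move: sb; rewrite le_eqVlt => /predU1P[<-//|sb].
pose y := Num.min b (s + d / 2).
have sy : s < y by rewrite lt_min sb ltrDl divr_gt0.
have yab : a <= y <= b by rewrite (le_trans as_ (ltW sy)) ge_min lexx.
have Sy : S y.
  split => //; apply: (le_trans Ss); apply: (hd _ yab).1; rewrite sy gt_min.
  by rewrite ltrD2l ltr_pdivrMr// ltr_pMr// ltr1n orbT.
by have : y <= s by [apply: ub_le_sup; [exists b|]]; rewrite leNgt sy.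
Qed.

Lemma derivable_increment_le (R : realType) (f : R -> R) (x r : R) :
  derivable f x 1 -> derive1 f x < r ->
  exists2 d, 0 < d & forall y, `|y - x| < d ->
    (x < y -> f y - f x <= r * (y - x)) /\ (y < x -> f x - f y <= r * (x - y)).
Proof.
move=> df; rewrite derive1E => dfr.
have : \forall h \near 0^', h^-1 *: (f (h *: 1 + x) - f x) < r by exact: (cvgr_lt _ df).
move=> /nbhs_ballP[d /= d0 hd]; exists d => // y yxd.
have key : y != x -> (y - x)^-1 * (f y - f x) < r.
  move=> yx; have := hd (y - x); rewrite /ball/= sub0r normrN => /(_ yxd).
  by rewrite subr_eq0 => /(_ yx); rewrite /GRing.scale/= mulr1 subrK.
split=> xy; have := key (_ : y != x).
  by rewrite gt_eqF// => /(_ isT)/ltW; rewrite mulrC ler_pdivrMr// subr_gt0.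
rewrite lt_eqF// => /(_ isT)/ltW; rewrite mulrC ler_ndivrMr ?subr_lt0//.
by rewrite -[f x - f y]opprB -[x - y]opprB mulrN lerN2.
Qed.

(** The difference between the indefinite integral of [v] and [f] increases
    locally at each x: near x the integrand stays above some r > f'(x) by lower
    semicontinuity, while f grows at rate less than r. *)
Lemma increment_le_integral_lsc (R : realType) (f : R -> R) (v : R -> \bar R)
    (a b : R) : a <= b ->
  (forall x, a <= x <= b -> derivable f x 1) ->
  (forall x, (0 <= v x)%E) -> lower_semicontinuous v ->
  (forall x, a <= x <= b -> ((derive1 f x)%:E < v x)%E) ->
  ((f b - f a)%:E <= \int[lebesgue_measure]_(x in `[a, b]) v x)%E.
Proof.
move=> ab df v0 lscv fv.
have mv (D : set R) : measurable_fun D v.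
  by apply: measurable_funTS; exact: lower_semicontinuous_measurable.
set I := (X in (_ <= X)%E).
have [Ioo|] := ltP I +oo%E; last by rewrite leye_eq => /eqP ->; rewrite leey.
have Ifin x : x <= b -> (\int[lebesgue_measure]_(x in `[a, x]) v x)%E \is a fin_num.
  move=> xb; rewrite ge0_fin_numE ?integral_ge0//; apply: le_lt_trans Ioo.
  apply: ge0_subset_integral => //=; first exact: mv.
  move=> z /=; rewrite !in_itv/= => /andP[-> zx].
  exact: le_trans zx xb.
pose h x := fine (\int[lebesgue_measure]_(x in `[a, x]) v x)%E - f x.
have split_at x y : a <= x -> x < y -> (\int[lebesgue_measure]_(z in `[a, y]) v z =
    \int[lebesgue_measure]_(z in `[a, x]) v z +
    \int[lebesgue_measure]_(z in `]x, y]) v z)%E.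
  move=> ax xy; rewrite -ge0_integral_setU//=; last 2 first.
  - exact: mv.
  - by apply/disj_setPS => z [] /=; rewrite !in_itv/= => /andP[_ zx] /andP[xz _]; lra.
  congr integral; apply/seteqP; split=> z /=; rewrite !in_itv/=; last first.
      by case=> /andP[h1 h2]; apply/andP; split; lra.
    move=> /andP[az zy]; have [zx|xz] := leP z x; first by left; rewrite az.
    by right; rewrite zy.
have step x y c : a <= x -> x < y -> y <= b -> 0 <= c ->
   (forall z, x < z <= y -> (c%:E <= v z)%E) -> f y - f x <= c * (y - x) -> h x <= h y.
  move=> ax xy yb c0 cv fxy.
  have xb : x <= b by apply: le_trans yb; exact: ltW.
  suff : c * (y - x) <= fine (\int[lebesgue_measure]_(z in `[a, y]) v z)%E -
                        fine (\int[lebesgue_measure]_(z in `[a, x]) v z)%E.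
    by rewrite /h; lra.
  rewrite -lee_fin EFinB !fineK ?Ifin// (split_at x y)// addeAC subee ?Ifin// add0e.
  apply: (@le_trans _ _ (\int[lebesgue_measure]_(z in `]x, y]) c%:E)%E).
    by rewrite integral_cst//= lebesgue_measure_itv/= lte_fin xy.
  by apply: ge0_le_integral => //=; exact: mv.
have : h a <= h b.
  apply: locally_increasing_le => // x xab.
  have [r fr rv] : exists2 r, derive1 f x < r & (r%:E < v x)%E.
    have := fv _ xab; case: (v x) => [c| |//] /=.
      rewrite lte_fin => fc; exists ((derive1 f x + c) / 2); rewrite ?lte_fin; lra.
    by move=> _; exists (derive1 f x + 1); rewrite ?ltry// ltrDl.
  have [V /nbhs_ballP[d1 /= d10 d1V] hV] := lscv _ _ rv.
  have [d2 d20 hd2] := derivable_increment_le (df _ xab) fr.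
  exists (Num.min d1 d2); first by rewrite lt_min d10.
  (* Replacing r by max r 0 makes the constant minorant of v nonnegative. *)
  have hmax z : `|z - x| < d1 -> ((Num.max r 0)%:E <= v z)%E.
    move=> zx; rewrite EFin_max ge_max v0 andbT; apply/ltW/hV/d1V.
    by rewrite /ball/= distrC.
  have cmp y z : y < z -> r * (z - y) <= Num.max r 0 * (z - y).
    by move=> yz; rewrite ler_wpM2r// ?le_max ?lexx// subr_ge0 ltW.
  move=> y /andP[ay yb]; case/andP: xab => ax xb; split=> /andP[].
    move=> xy; rewrite -ltrBlDl lt_min => /andP[yd1 yd2].
    apply: (step x y (Num.max r 0)) => //; first by rewrite le_max lexx orbT.
      by move=> z /andP[xz zy]; apply: hmax; rewrite ger0_norm; lra.
    apply: le_trans (cmp _ _ xy); apply: (hd2 y _).1 => //.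
    by rewrite ger0_norm; lra.
  rewrite ltrBlDl -ltrBlDr lt_min => /andP[yd1 yd2] yx.
  apply: (step y x (Num.max r 0)) => //; first by rewrite le_max lexx orbT.
    by move=> z /andP[xz zy]; apply: hmax; rewrite ler0_norm; lra.
  apply: le_trans (cmp _ _ yx); apply: (hd2 y _).2 => //.
  by rewrite ltr0_norm; lra.
rewrite /h set_itv1 integral_set1/= sub0r lerBrDr addrC -lee_fin fineK//.
exact: Ifin.
Qed.

(** * The fundamental theorem for everywhere differentiable functions *)

Lemma increment_le_integral_ge0 (R : realType) (f phi : R -> R) (a b : R) :
  a <= b -> (forall x, a <= x <= b -> derivable f x 1) ->
  measurable_fun `[a, b] phi -> (forall x, a <= x <= b -> 0 <= phi x) ->
  (forall x, a <= x <= b -> derive1 f x <= phi x) ->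
  ((f b - f a)%:E <= \int[lebesgue_measure]_(x in `[a, b]) (phi x)%:E)%E.
Proof.
move=> ab df mphi phi0 fphi; apply/lee_addgt0Pr => e e0.
have abfin : (lebesgue_measure `[a, b]%classic < +oo :> \bar R)%E.
  by rewrite lebesgue_measure_itv/=; case: ifP => _; rewrite ?ltry.
have [||v [v0 lscv phiv vphi]] := vitali_caratheodory _ abfin mphi _ e0.
- exact: measurable_itv.
- by move=> x /=; rewrite in_itv/=; exact: phi0.
apply: le_trans vphi; apply: increment_le_integral_lsc => // x xab.
by apply: le_lt_trans (phiv _ _); rewrite ?lee_fin ?fphi//= in_itv.
Qed.

(** The bound for nonnegative majorants applies to f + n x, whose derivative
    lies below max(f', -n) + n; the truncations max(f', -n) converge to f'
    dominatedly. *)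
Lemma increment_le_integral (R : realType) (f : R -> R) (a b : R) :
  a <= b -> (forall x, a <= x <= b -> derivable f x 1) ->
  lebesgue_measure.-integrable `[a, b] (EFin \o derive1 f) ->
  ((f b - f a)%:E <= \int[lebesgue_measure]_(x in `[a, b]) (derive1 f x)%:E)%E.
Proof.
move=> ab df if'.
have mf' : measurable_fun `[a, b] (derive1 f).
  by apply/measurable_EFinP; exact: measurable_int if'.
pose g n x := Num.max (derive1 f x) (- n%:R).
have mg n : measurable_fun `[a, b] (g n) by apply: measurable_maxr.
have g_le n x : `|g n x| <= `|derive1 f x|.
  rewrite /g; case: (leP (derive1 f x) (- n%:R)) => // h.
  have n0 := ler0n R n; rewrite normrN normr_nat ler0_norm; lra.
have ig n : lebesgue_measure.-integrable `[a, b] (EFin \o g n).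
  apply: le_integrable if' => //; first by apply/measurable_EFinP; exact: mg.
  by move=> x _ /=; rewrite lee_fin.
have derf n x : a <= x <= b ->
    is_derive x 1 (fun x => f x + n%:R * x) (derive1 f x + n%:R).
  move=> xab; have := derivableP (df _ xab) => dfx.
  by rewrite derive1E; apply: is_derive_eq; rewrite /GRing.scale/= mulr1.
have gle n : ((f b - f a)%:E <= \int[lebesgue_measure]_(x in `[a, b]) (g n x)%:E)%E.
  have /= : (((f b + n%:R * b) - (f a + n%:R * a))%:E <=
      \int[lebesgue_measure]_(x in `[a, b]) (g n x + n%:R)%:E)%E.
    apply: (@increment_le_integral_ge0 _ (fun x => f x + n%:R * x)) => //.
    - by move=> x xab; case: (derf n x xab).
    - by apply: measurable_funD; [exact: mg|].
    - by move=> x _; rewrite -lerBlDr sub0r le_max lexx orbT.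
    - move=> x xab; rewrite derive1E; case: (derf n x xab) => _ ->.
      by rewrite lerD2r le_max lexx.
  under eq_integral do rewrite EFinD.
  rewrite integralD//=; [|exact: ig|
    by apply: continuous_compact_integrable; [exact: segment_compact|move=> ?; exact: cst_continuous]].
  rewrite integral_cst//= lebesgue_measure_itv/= lte_fin.
  have [->|ab'] := eqVneq a b.
    by rewrite ltxx mule0 adde0 opprD addrACA !subrr addr0.
  rewrite lt_neqAle ab' ab/= -EFinB -EFinM -leeBlDr// -EFinB.
  by apply: le_trans; rewrite lee_fin; lra.
have [||||||_ _ cvg_g] := @dominated_convergence _ _ _ lebesgue_measure `[a, b]%classic _
    (fun n => EFin \o g n) (EFin \o derive1 f) (abse \o (EFin \o derive1 f)); first exact: measurable_itv.
- by move=> n; apply/measurable_EFinP; exact: mg.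
- exact/measurable_EFinP.
- apply: aeW => x _; apply: cvg_near_cst.
    near=> n; rewrite /= /g; congr EFin; apply/max_idPl.
    rewrite lerNl; near: n; exact: nbhs_infty_ger.
- exact: integrable_abse.
- by apply: aeW => x n _; rewrite /= lee_fin.
rewrite -(cvg_lim _ cvg_g)//; apply: lime_ge; first by apply/cvg_ex; eexists; exact: cvg_g.
exact: nearW.
Unshelve. all: by end_near.
Qed.

(** The fundamental theorem of calculus without continuity of the derivative;
    the two inequalities come from [increment_le_integral] for f and - f. *)
Lemma integral_derive1 (R : realType) (f : R -> R) (a b : R) :
  a <= b -> (forall x, a <= x <= b -> derivable f x 1) ->
  lebesgue_measure.-integrable `[a, b] (EFin \o derive1 f) ->
  (\int[lebesgue_measure]_(x in `[a, b]) (derive1 f x)%:E = (f b - f a)%:E)%E.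
Proof.
move=> ab df if'; apply/eqP; rewrite eq_le increment_le_integral// andbT.
have dfN x : a <= x <= b -> derive1 (- f) x = - derive1 f x.
  by move=> xab; rewrite !derive1E deriveN//; exact: df.
have : ((- f b - - f a)%:E <= \int[lebesgue_measure]_(x in `[a, b]) (derive1 (- f) x)%:E)%E.
  apply: (@increment_le_integral _ (- f)) => //.
    by move=> x xab; apply: derivableN; exact: df.
  have := integrableN if'; apply: eq_integrable; first exact: measurable_itv.
  by move=> x; rewrite inE/= in_itv => /dfN /= ->.
have -> : (\int[lebesgue_measure]_(x in `[a, b]) (derive1 (- f) x)%:E =
           - \int[lebesgue_measure]_(x in `[a, b]) (derive1 f x)%:E)%E.
  rewrite -integralN; last exact: integrable_add_def.
  by apply: eq_integral => x; rewrite inE/= in_itv => /dfN ->.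
by rewrite leeNr -EFinN opprB opprK addrC.
Qed.

Lemma derivable_measurable_fun (R : realType) (f : R -> R) :
  (forall x : R, derivable f x 1) -> measurable_fun setT f.
Proof.
move=> df; apply: continuous_measurable_fun => x.
exact/differentiable_continuous/derivable1_diffP.
Qed.

Lemma measurable_derive1 (R : realType) (f : R -> R) :
  (forall x, derivable f x 1) -> measurable_fun setT (derive1 f).
Proof.
move=> df.
have mf := derivable_measurable_fun df.
pose h n x := n.+1%:R * (f (n.+1%:R^-1 + x) - f x).
apply: (@measurable_fun_cvg _ _ _ _ h) => [n|x _].
  apply: measurable_funM => //; apply: measurable_funB => //.
  by apply: measurableT_comp => //; exact: measurable_funD.
have := df x; rewrite derive1E /h => dfx.
have : (fun n => n.+1%:R^-1 : R) @ \oo --> 0^'.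
  move=> A A0.
  have : \forall n \near \oo, (n.+1%:R^-1 : R) != 0 -> A (n.+1%:R^-1).
    exact: (@cvg_harmonic R _ A0).
  by apply: (filterS (F := \oo)) => n; apply; rewrite invr_neq0// pnatr_eq0.
move=> /(cvg_comp _ _)/(_ dfx); apply: cvg_trans; apply: near_eq_cvg.
by near=> n; rewrite /= invrK /GRing.scale/= mulr1.
Unshelve. all: by end_near. Qed.

(** * The operator T and difference quotients at the origin *)

(** The k-th derivative of x f'(x), by Leibniz' rule. *)
Lemma derive1n_T_op (R : realType) (n : nat) (f : R -> R) :
  n_times_derivable n.+1 f -> forall k, (k <= n)%N -> forall x,
  derive1n k (T_op f) x = x * derive1n k.+1 f x + k%:R * derive1n k f x.
Proof.
move=> df; elim=> [_ x|k IH kn x]; first by rewrite mul0r addr0.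
have -> : derive1n k.+1 (T_op f) = derive1 (derive1n k (T_op f)) by [].
have -> : derive1n k (T_op f) = (fun x => x * derive1n k.+1 f x + k%:R * derive1n k f x).
  by apply/funext => y; rewrite IH// ltnW.
rewrite derive1E.
have d1 := derivableP (df k (ltnW kn) x).
have d2 := derivableP (df k.+1 kn x).
rewrite -derive1E in d1; rewrite -derive1E in d2.
set c := k%:R.
have -> : 'D_1 (fun y : R => y * derive1n k.+1 f y + c * derive1n k f y) x =
   (x *: derive1 (derive1n k.+1 f) x + derive1n k.+1 f x *: 1) + c *: derive1 (derive1n k f) x.
  exact: derive_val.
rewrite /GRing.scale/= mulr1 -addrA; congr (_ + _).
by rewrite -natr1 mulrDl mul1r addrC.
Qed.

Lemma n_times_derivable_T_op (R : realType) (n : nat) (f : R -> R) :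
  n_times_derivable n.+1 f -> n_times_derivable n (T_op f).
Proof.
move=> df k kn x.
have -> : derive1n k (T_op f) = (fun x => x * derive1n k.+1 f x + k%:R * derive1n k f x).
  by apply/funext => y; rewrite (derive1n_T_op df)// ltnW.
apply: derivableD; apply: derivableM => //; first exact: df.
by apply: df; rewrite (ltn_trans kn).
Qed.

Lemma derivable_iter_T_op (R : realType) (n k : nat) (f : R -> R) (x : R) :
  n_times_derivable n f -> (k < n)%N -> derivable (iter k (@T_op R) f) x 1.
Proof.
elim: k n f => [|k IH] [//|n] f df kn; first exact: (df 0).
by rewrite iterSr; apply: (IH n) => //; exact: n_times_derivable_T_op.
Qed.

(** The value at 0 is 0, by the convention 0^-1 = 0, and not F'(0): the identity
    of [slope0_T_op] thus holds only off the origin, hence almost everywhere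
    for the variables considered below. *)
Definition slope0 (R : realType) (F : R -> R) (x : R) : R := x^-1 * (F x - F 0).

Lemma slope0_T_op (R : realType) (f : R -> R) (x : R) :
  x != 0 -> slope0 (T_op f) x = derive1 f x.
Proof. by move=> x0; rewrite /slope0 /T_op mul0r subr0 mulKf. Qed.

(** For the measurability of the inverse, x^-1 = x (x^2)^-1 reduces to the
    power function on nonnegative arguments. *)
Lemma measurable_slope0 (R : realType) (F : R -> R) :
  measurable_fun setT F -> measurable_fun setT (slope0 F).
Proof.
move=> mF; suff mV : measurable_fun setT (@GRing.inv R).
  by apply: measurable_funM => //; exact: measurable_funB.
have -> : (@GRing.inv R) = (fun x => x * (x ^+ 2) `^ (-1)).
  apply/funext => x; rewrite powR_inv1 ?sqr_ge0//.
  have [->|x0] := eqVneq x 0; first by rewrite invr0 mul0r.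
  by rewrite expr2 invfM mulrA divff// mul1r.
apply: measurable_funM => //.
apply: (measurableT_comp (measurable_powR (-1))).
exact: measurable_funX.
Qed.

(** The integrand is the derivative of u |-> F(u x) / x. *)
Lemma integral_derive1_dilation (R : realType) (F : R -> R) (x : R) :
  (forall y : R, derivable F y 1) -> x != 0 ->
  lebesgue_measure.-integrable `[0, 1] (fun u => (derive1 F (u * x))%:E) ->
  (\int[lebesgue_measure]_(u in `[0%R, 1%R]) (derive1 F (u * x))%:E = (slope0 F x)%:E)%E.
Proof.
move=> dF x0 iF; pose G (u : R) := x^-1 * F (u * x).
have dG (u : R) : is_derive u 1 G (derive1 F (u * x)).
  have := derivableP (dF (u * x)); rewrite -derive1E => dFx.
  have dux : is_derive u 1 ( *%R^~ x) x.
    by apply: is_derive_eq; rewrite scaler0 add0r /GRing.scale/= mulr1.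
  have h : is_derive u 1 (F \o *%R^~ x) (derive1 F (u * x) * x) by exact: is_derive1_comp.
  have -> : G = x^-1 *: (F \o *%R^~ x) by [].
  apply: is_derive_eq.
  by rewrite /GRing.scale/= mulrCA mulVf// mulr1.
have GE (u : R) : derive1 G u = derive1 F (u * x) by rewrite derive1E; apply: derive_val.
have GE1 : derive1 G = (fun u => derive1 F (u * x)) by apply/funext => u; exact: GE.
have := @integral_derive1 _ G 0 1 ler01.
rewrite GE1 => -> //; first by rewrite /G mul1r mul0r -mulrBr.
Qed.

(** The uniform distribution lives on [measurableTypeR R], whose sigma-algebra
    is that of [R] under another display.  The next lemmas transfer its
    integrals, through the identity map, to laws of random variables on [R]. *)
Section standard_uniform_law.
Variables (R : realType) (Q : probability R R).
Hypothesis hQ : same_law Q (uniform_prob (@ltr01 R)).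

Let ge0_integral_standard_uniform (f : R -> \bar R) :
  measurable_fun setT f -> (forall u, 0 <= f u)%E ->
  (\int[Q]_u f u = \int[lebesgue_measure]_(u in `[0%R, 1%R]) f u)%E.
Proof.
move=> mf f0; pose idR : measurableTypeR R -> R := idfun.
have midR : measurable_fun setT idR by move=> _ A mA; rewrite setTI.
pose uniform : {measure set R -> \bar R} := pushforward (uniform_prob (@ltr01 R)) idR.
rewrite (@eq_measure_integral _ _ _ setT (uniform midR)) => [|A mA _]; last exact: hQ.
rewrite ge0_integral_pushforward// integral_uniform// subr0 invr1 mul1e.
by [].
Qed.

Lemma integral_standard_uniform (f : R -> \bar R) : measurable_fun setT f ->
  (\int[Q]_u f u = \int[lebesgue_measure]_(u in `[0%R, 1%R]) f u)%E.
Proof.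
move=> mf; rewrite integralE [in RHS]integralE.
by rewrite !ge0_integral_standard_uniform//; [exact: measurable_funeneg|exact: measurable_funepos].
Qed.

Lemma integrable_standard_uniform (f : R -> \bar R) :
  Q.-integrable setT f -> lebesgue_measure.-integrable `[0, 1] f.
Proof.
move=> /integrableP[mf foo]; apply/integrableP; split; first exact: measurable_funTS.
by rewrite -integral_standard_uniform//; exact: measurableT_comp.
Qed.

Lemma standard_uniform_set1 (x : R) : Q [set x] = 0%E.
Proof.
rewrite hQ; last exact: measurable_set1.
have /null_content_dominatesP := dominates_uniform_prob (@ltr01 R).
by apply; [exact: measurable_set1|exact: lebesgue_measure_set1].
Qed.

End standard_uniform_law.

(** * Independence of the successive uniform factors *)

(** Rectangles form a pi-system generating the product sigma-algebra, so that
    the two finite measures D |-> P((X, Y) in D, E) and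
    D |-> P((X, Y) in D) P(E) agree everywhere once they agree there. *)
Lemma independent_event_pair (R : realType) d (T : measurableType d)
    (P : probability T R) d1 d2 (S1 : measurableType d1) (S2 : measurableType d2)
    (X : T -> S1) (Y : T -> S2) (E : set T) :
  measurable_fun setT X -> measurable_fun setT Y -> measurable E ->
  (forall A B, measurable A -> measurable B ->
    P (X @^-1` A `&` Y @^-1` B `&` E) = (P (X @^-1` A `&` Y @^-1` B) * P E)%E) ->
  forall D : set (S1 * S2), measurable D ->
    P ((fun t => (X t, Y t)) @^-1` D `&` E) =
    (P ((fun t => (X t, Y t)) @^-1` D) * P E)%E.
Proof.
move=> mX mY mE indep D mD.
pose Z t := (X t, Y t).
have mZ : measurable_fun setT Z by exact: measurable_fun_pair.
have PE0 : 0 <= fine (P E) by rewrite fine_ge0.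
pose Zm : {mfun T >-> (S1 * S2)%type} := HB.pack Z (isMeasurableFun.Build _ _ _ _ Z mZ).
pose m1 : {measure set (S1 * S2)%type -> \bar R} := pushforward (mrestr P mE) Z.
pose m2 : {measure set (S1 * S2)%type -> \bar R} := mscale (NngNum PE0) (distribution P Zm).
have m2E A : m2 A = (P (Z @^-1` A) * P E)%E.
  by rewrite muleC -[in RHS](@fineK _ (P E)) ?fin_num_measure.
rewrite -[RHS]m2E -[LHS]/(m1 mZ D).
pose C : set (set (S1 * S2)) :=
  [set C | exists A, measurable A /\ exists B, measurable B /\ C = A `*` B].
apply: (measure_unique C (fun=> setT)) => //.
- rewrite measurable_prod_measurableType //; congr (<<s _ >>).
  rewrite predeqE; split => [[A mA [B mB <-]]|[A [mA [B [mB ->]]]]].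
    by exists A; split => //; exists B.
  by exists A => //; exists B.
- move=> /= _ _ [X1 [mX1 [X2 [mX2 ->]]]] [Y1 [mY1 [Y2 [mY2 ->]]]].
  rewrite -setXI; exists (X1 `&` Y1); split; first exact: measurableI.
  by exists (X2 `&` Y2); split => //; exact: measurableI.
- by move=> _; exists setT; split => //; exists setT; split => //; rewrite setXTT.
- by rewrite bigcup_const//; exists 0%N.
- move=> _ [A [mA [B [mB ->]]]]; rewrite m2E; exact: indep.
- move=> k; rewrite /= /pushforward preimage_setT /mrestr setTI.
  by rewrite -ge0_fin_numE// fin_num_measure.
Qed.

Section partial_products.
Variables (R : realType) (n : nat).
Variables (d : measure_display) (T : measurableType d) (P : probability T R).
Variables (W : {RV P >-> R}) (U : 'I_n -> {RV P >-> R}).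
Hypothesis hUind : mutually_independent P (fun (k : 'I_n) (t : T) => U k t).
Hypothesis hUW : independent2 P (fun t : T => [tuple U k t | k < n]) W.

Definition partial_prod (k : nat) (t : T) : R := (\prod_(i < n | (i < k)%N) U i t) * W t.

Lemma partial_prod0 : partial_prod 0 = W.
Proof. by apply/funext => t; rewrite /partial_prod big_pred0 ?mul1r. Qed.

Lemma partial_prodS (k : 'I_n) t : partial_prod k.+1 t = U k t * partial_prod k t.
Proof.
rewrite /partial_prod mulrA (bigD1 k)//=; congr (_ * _ * _).
by apply: eq_bigl => i; rewrite ltnS ltn_neqAle andbC.
Qed.

Lemma measurable_partial_prod k : measurable_fun setT (partial_prod k).
Proof.
apply: measurable_funM => //.
under eq_fun do rewrite big_mkcond/=.
apply: (measurable_prod (h := fun (i : 'I_n) t => if (i < k)%N then U i t else 1)) => i _.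
by case: (i < k)%N.
Qed.

Let tail (k : nat) (B : 'I_n -> set R) : set T :=
  [set t | forall i : 'I_n, (k <= i)%N -> B i (U i t)].

Lemma measurable_tail k B : (forall i, measurable (B i)) -> measurable (tail k B).
Proof.
move=> mB.
have -> : tail k B = \bigcap_(i in [set i : 'I_n | (k <= i)%N]) (U i @^-1` B i) by [].
apply: fin_bigcap_measurable => [|i _]; first exact: finite_finset.
by rewrite -[X in measurable X]setTI; exact: measurable_funPT.
Qed.

(** The induction hypothesis carries all the remaining factors U_i, i >= k, and
    not just the next one, since multiplying by U_k must preserve independence
    from the others. *)
Let indep_tail (k : nat) : Prop :=
  forall (C : set R) (B : 'I_n -> set R), measurable C -> (forall i, measurable (B i)) ->
  P (partial_prod k @^-1` C `&` tail k B) =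
  (P (partial_prod k @^-1` C) * \prod_(i < n | (k <= i)%N) P (U i @^-1` B i))%E.

Let indep_tail_cut (k : 'I_n) : indep_tail k ->
  forall (C A : set R) (B : 'I_n -> set R),
  measurable C -> measurable A -> (forall i, measurable (B i)) ->
  P (partial_prod k @^-1` C `&` U k @^-1` A `&` tail k.+1 B) =
  (P (partial_prod k @^-1` C) * (P (U k @^-1` A) *
    \prod_(i < n | (k < i)%N) P (U i @^-1` B i)))%E.
Proof.
move=> hk C A B mC mA mB.
have tail_split : tail k (fun i => if i == k then A else B i) =
    U k @^-1` A `&` tail k.+1 B.
  apply/seteqP; split=> t /= h.
    split; first by have := h k; rewrite eqxx; apply.
    move=> i ki; have := h i (ltnW ki).
    by rewrite -val_eqE/= gtn_eqF.
  move=> i ki; case: eqP => [->|/eqP ik]; first exact: h.1.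
  by apply: h.2; rewrite ltn_neqAle ki andbT eq_sym.
rewrite -setIA -tail_split hk//; last by move=> i; case: ifP.
congr (_ * _)%E; rewrite (bigD1 k)//= eqxx; congr (_ * _)%E.
apply: eq_big => [i|i /andP[_ /negbTE ->]//].
by rewrite ltn_neqAle andbC eq_sym.
Qed.

Let indep_tail_pair (k : 'I_n) : indep_tail k ->
  independent2 P (partial_prod k) (U k).
Proof.
move=> hk C A mC mA.
have := indep_tail_cut hk mC mA (fun=> measurableT).
have -> : tail k.+1 (fun=> setT) = setT by apply/seteqP; split.
rewrite setIT => ->; rewrite big1 ?mule1// => i _.
by rewrite preimage_setT probability_setT.
Qed.

Let indep_tailP (k : nat) : (k <= n)%N -> indep_tail k.
Proof.
elim: k => [_|k IH kn] C B mC mB.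
  rewrite partial_prod0 setIC.
  pose D : set (n.-tuple R) := [set v | forall i, B i (tnth v i)].
  have mD : measurable D.
    have -> : D = \bigcap_(i in [set: 'I_n]) ((@tnth _ R ^~ i) @^-1` B i).
      by apply/seteqP; split=> [v Dv i _|v Dv i]; [exact: Dv|exact: (Dv i I)].
    apply: fin_bigcap_measurable => [|i _]; first exact: finite_finset.
    by rewrite -[X in measurable X]setTI; exact: measurable_tnth.
  have -> : tail 0 B = (fun t : T => [tuple U k t | k < n]) @^-1` D.
    apply/seteqP; split=> t /= Bt i; first by rewrite tnth_mktuple; exact: Bt.
    by move=> _; have := Bt i; rewrite tnth_mktuple.
  rewrite hUW// muleC; congr (_ * _)%E.
  have := hUind [set: 'I_n]%SET mB.
  have -> : \bigcap_(i in [set` [set: 'I_n]%SET]) (fun t => U i t) @^-1` B i =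
    (fun t : T => [tuple U k t | k < n]) @^-1` D.
    apply/seteqP; split=> t /= Bt i; first by rewrite tnth_mktuple; apply: Bt => /=; rewrite inE.
    by move=> _; have := Bt i; rewrite tnth_mktuple.
  by move=> ->; apply: eq_bigl => i; rewrite inE.
pose kk : 'I_n := Ordinal kn.
have hk : indep_tail kk by apply: IH; exact: ltnW.
have PE : P (tail k.+1 B) = (\prod_(i < n | (k < i)%N) P (U i @^-1` B i))%E.
  have := indep_tail_cut hk measurableT measurableT mB.
  by rewrite !preimage_setT !setTI probability_setT !mul1e.
rewrite -PE.
have -> : partial_prod k.+1 @^-1` C = (fun t => (partial_prod k t, U kk t)) @^-1`
    [set p | C (p.2 * p.1)].
  by apply/seteqP; split=> t /=; rewrite (partial_prodS kk).
apply: independent_event_pair => //.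
- exact: measurable_partial_prod.
- exact: measurable_tail.
- by move=> A A' mA mA'; rewrite (indep_tail_cut hk)// -PE (indep_tail_pair hk)// muleA.
- rewrite -[X in measurable X]setTI; exact: measurable_funM.
Qed.

Lemma independent2_partial_prod (k : 'I_n) : independent2 P (partial_prod k) (U k).
Proof. by apply/indep_tail_pair/indep_tailP; exact: ltnW. Qed.

End partial_products.

(** * Averaging out one uniform factor *)

Lemma ae_eq_integrable (R : realType) d (T : measurableType d)
    (mu : {measure set T -> \bar R}) (f g : T -> \bar R) :
  measurable_fun setT g -> ae_eq mu setT f g ->
  mu.-integrable setT f -> mu.-integrable setT g.
Proof.
move=> mg fg /integrableP[mf foo]; apply/integrableP; split => //.
rewrite (ae_eq_integral (abse \o f)) //; try exact: measurableT_comp.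
by apply: filterS fg => x /= h _; rewrite h.
Qed.

(** Conditionally on X = x, the mean of F'(U x) is the slope of F from 0 to x;
    Fubini's theorem on the joint law of X and U, a product by independence,
    provides both the integrability needed for almost every x and the
    integrability of the conditional mean. *)
Lemma integral_uniform_mul (R : realType) d (T : measurableType d)
    (P : probability T R) (X U : {RV P >-> R}) (F : R -> R) :
  same_law (distribution P U) (uniform_prob (@ltr01 R)) -> independent2 P X U ->
  P (X @^-1` [set 0]) = 0%E -> (forall x : R, derivable F x 1) ->
  P.-integrable setT (fun t => (derive1 F (U t * X t))%:E) ->
  P.-integrable setT (fun t => (slope0 F (X t))%:E) /\
  (\int[P]_t (derive1 F (U t * X t))%:E = \int[P]_t (slope0 F (X t))%:E)%E.
Proof.
move=> hU indep X0 dF iF.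
pose m1 : probability _ R := distribution P X.
pose m2 : probability _ R := distribution P U.
pose Z t := (X t, U t).
have mZ : measurable_fun setT Z by exact: measurable_fun_pair.
pose Zm : {mfun T >-> (R * R)%type} := HB.pack Z (isMeasurableFun.Build _ _ _ _ Z mZ).
pose m3 : probability _ R := distribution P Zm.
have lawZ D : measurable D -> (m1 \x m2)%E D = m3 D.
  move=> mD; have := @product_measure_unique _ _ _ _ _ m1 m2 m3; exact.
pose f (p : R * R) : \bar R := (derive1 F (p.2 * p.1))%:E.
have mF' := measurable_derive1 dF.
have mF := derivable_measurable_fun dF.
have mf : measurable_fun setT f.
  apply/measurable_EFinP; apply: (measurableT_comp mF').
  exact: measurable_funM.
have if_ : (m1 \x m2)%E.-integrable setT f.
  apply/integrableP; split => //.
  rewrite (eq_measure_integral m3) => [|A mA _]; last exact: lawZ.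
  rewrite ge0_integral_distribution//; last exact: measurableT_comp.
  by case/integrableP: iF.
have intf : (\int[m1 \x m2]_p f p = \int[P]_t (derive1 F (U t * X t))%:E)%E.
  rewrite (eq_measure_integral m3) => [|A mA _]; last exact: lawZ.
  by rewrite integral_distribution.
have X0ae : {ae m1, forall x, x != 0}.
  exists [set 0]; split => //.
  by move=> x /= /negP; rewrite negbK => /eqP.
have inner : {ae m1, forall x, (fubini_F m2 f x = (slope0 F x)%:E)%E}.
  have := ae_integrable1 if_.
  apply: filterS2 X0ae => x x0 ix.
  rewrite /fubini_F /f/= (integral_standard_uniform hU); last exact: measurable_int ix.
  by apply: integral_derive1_dilation => //; exact: (integrable_standard_uniform hU).
have mslope : measurable_fun setT (EFin \o slope0 F).
  by apply/measurable_EFinP; exact: (measurable_slope0 mF).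
have islope : m1.-integrable setT (EFin \o slope0 F).
  apply: ae_eq_integrable (integrable_fubini_F if_) => //.
  by apply: filterS inner => x /= -> _.
have islopeX : P.-integrable setT (fun t => (slope0 F (X t))%:E).
  apply/integrableP; split; first exact: (measurableT_comp mslope).
  case/integrableP : islope => _; rewrite ge0_integral_distribution//.
  exact: measurableT_comp.
split=> //; rewrite -intf -integral12_prod_meas1//.
transitivity (\int[m1]_x (EFin \o slope0 F) x)%E.
  apply: ae_eq_integral => //; first exact: (measurable_fubini_F if_).
  by apply: filterS inner => x /= -> _.
by rewrite integral_distribution.
Qed.

Section averaging_all_factors.
Variables (R : realType) (n : nat).
Variables (d : measure_display) (T : measurableType d) (P : probability T R).
Variables (W : {RV P >-> R}) (U : 'I_n -> {RV P >-> R}).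
Hypothesis hU : forall k : 'I_n, same_law (distribution P (U k)) (uniform_prob (@ltr01 R)).
Hypothesis hUind : mutually_independent P (fun (k : 'I_n) (t : T) => U k t).
Hypothesis hUW : independent2 P (fun t : T => [tuple U k t | k < n]) W.
Hypothesis W0 : P (W @^-1` [set 0]) = 0%E.

Let X (k : nat) : T -> R := partial_prod W U k.

HB.instance Definition _ (k : nat) :=
  isMeasurableFun.Build _ _ _ _ (X k) (measurable_partial_prod W U k).

Lemma partial_prod_ae_neq0 (k : nat) : (k <= n)%N -> P (partial_prod W U k @^-1` [set 0]) = 0%E.
Proof.
elim: k => [_|k IH kn]; first by rewrite partial_prod0.
pose kk : 'I_n := Ordinal kn.
have U0 : P (U kk @^-1` [set 0]) = 0%E.
  exact: (standard_uniform_set1 (hU kk) 0).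
have -> : partial_prod W U k.+1 @^-1` [set 0] =
    (U kk @^-1` [set 0]) `|` (partial_prod W U k @^-1` [set 0]).
  apply/seteqP; split=> t /=; rewrite (partial_prodS W U kk).
    by move=> /eqP; rewrite mulf_eq0 => /orP[/eqP ->|/eqP ->]; [left|right].
  by case=> ->; rewrite ?mul0r ?mulr0.
have mU : measurable (U kk @^-1` [set 0]).
  by rewrite -[X in measurable X]setTI; exact: measurable_funPT.
have mX : measurable (partial_prod W U k @^-1` [set 0]).
  by rewrite -[X in measurable X]setTI; exact: measurable_partial_prod.
by rewrite -U0; apply: (measureU0 mU mX); apply: IH; exact: ltnW.
Qed.

Lemma integral_derive1_partial_prod (k : 'I_n) (F : R -> R) :
  (forall x : R, derivable F x 1) ->
  P.-integrable setT (fun t => (derive1 F (partial_prod W U k.+1 t))%:E) ->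
  P.-integrable setT (fun t => (slope0 F (partial_prod W U k t))%:E) /\
  (\int[P]_t (derive1 F (partial_prod W U k.+1 t))%:E =
   \int[P]_t (slope0 F (partial_prod W U k t))%:E)%E.
Proof.
move=> dF; have -> : (fun t => (derive1 F (partial_prod W U k.+1 t))%:E) =
    (fun t => (derive1 F (U k t * X k t))%:E).
  by apply/funext => t; rewrite (partial_prodS W U k).
apply: (@integral_uniform_mul _ _ _ _ (X k)) => //.
- exact: (independent2_partial_prod hUind hUW).
- by apply: partial_prod_ae_neq0; exact: ltnW.
Qed.

(** Each application of [integral_derive1_partial_prod] removes one uniform
    factor and, through [slope0_T_op], one operator T. *)
Lemma integral_derive1_iter_T_op (f : R -> R) (k : nat) :
  n_times_derivable n f -> (k < n)%N ->
  P.-integrable setT (fun t => (derive1 (iter k (@T_op R) f) (partial_prod W U k.+1 t))%:E) ->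
  P.-integrable setT (fun t => (slope0 f (W t))%:E) /\
  (\int[P]_t (derive1 (iter k (@T_op R) f) (partial_prod W U k.+1 t))%:E =
   \int[P]_t (slope0 f (W t))%:E)%E.
Proof.
move=> df; elim: k => [|k IH] kn.
  move=> /(@integral_derive1_partial_prod (Ordinal kn) f (df 0%N kn)).
  by rewrite partial_prod0.
have dg (x : R) : derivable (iter k.+1 (@T_op R) f) x 1 by exact: (derivable_iter_T_op df kn).
move=> /(@integral_derive1_partial_prod (Ordinal kn) _ dg)[iX ->].
set g := iter k (@T_op R) f.
have dg' (x : R) : derivable g x 1 by exact: (derivable_iter_T_op df (ltnW kn)).
have mslope : measurable_fun setT (fun t => (slope0 (T_op g) (X k.+1 t))%:E).
  exact: measurable_int iX.
have mder : measurable_fun setT (fun t => (derive1 g (X k.+1 t))%:E).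
  apply/measurable_EFinP; apply: (measurableT_comp (measurable_derive1 dg')).
  exact: measurable_partial_prod.
have ae_slope : ae_eq P setT (fun t => (slope0 (T_op g) (X k.+1 t))%:E)
    (fun t => (derive1 g (X k.+1 t))%:E).
  exists (X k.+1 @^-1` [set 0]); split.
  - rewrite -[X in measurable X]setTI; exact: measurable_funPT.
  - by apply: partial_prod_ae_neq0; exact: ltnW.
  - move=> t /= ht; apply: contrapT => /eqP Xt0; apply: ht => _.
    by rewrite slope0_T_op.
have -> : (\int[P]_t (slope0 (iter k.+1 (@T_op R) f) (partial_prod W U (Ordinal kn) t))%:E =
    \int[P]_t (derive1 g (X k.+1 t))%:E)%E by exact: ae_eq_integral.
apply: IH; first exact: ltnW.
exact: ae_eq_integrable ae_slope iX.
Qed.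

End averaging_all_factors.

(** * Square bias and conclusion *)

(** The square bias weights the law of W by w^2, which vanishes at 0: the
    indicator of 0 is the test function. *)
Lemma square_biased_neq0 (R : realType)
    d0 (T0 : measurableType d0) (P0 : probability T0 R) (W : {RV P0 >-> R})
    d (T : measurableType d) (P : probability T R) (Wsq : {RV P >-> R}) :
  square_biased P0 W P Wsq -> ('E_P0[(fun t => W t ^+ 2)%R] != 0)%E ->
  P (Wsq @^-1` [set 0]) = 0%E.
Proof.
move=> hsq W2.
have W10 t : W t ^+ 2 * \1_[set 0] (W t) = 0 :> R.
  rewrite indicE; case: (boolP (_ \in _)) => [/set_mem /= ->|_].
    by rewrite expr0n mul0r.
  by rewrite mulr0.
have m1 : measurable_fun setT (\1_[set 0] : R -> R).
  by apply: measurable_indic; exact: measurable_set1.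
have := hsq _ m1; rewrite (_ : (fun t => (W t ^+ 2 * \1_[set 0] (W t))%:E) = cst 0%E); last first.
  by apply/funext => t; rewrite W10.
have -> : (fun t => W t ^+ 2 * \1_[set 0] (W t)) = cst 0 by apply/funext => t; rewrite W10.
rewrite expectation_cst => /(_ (integrable0 _ _))/esym/eqP.
rewrite mule_eq0 (negbTE W2)/= => /eqP.
have -> : (fun t => \1_[set 0] (Wsq t)) = \1_(Wsq @^-1` [set 0]) :> (T -> R).
  by apply/funext.
by rewrite expectation_indic.
Qed.

(** The test function is [slope0 f], for which W^2 slope0 f(W) = W f(W) - W f(0)
    even where W vanishes; the last term has mean 0. *)
Lemma square_biased_slope0 (R : realType)
    d0 (T0 : measurableType d0) (P0 : probability T0 R) (W : {RV P0 >-> R})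
    d (T : measurableType d) (P : probability T R) (Wsq : {RV P >-> R}) (f : R -> R) :
  (W : T0 -> R) \in Lfun P0 1 -> ('E_P0[W] = 0)%E ->
  square_biased P0 W P Wsq -> measurable_fun setT f ->
  P0.-integrable setT (fun t => (W t * f (W t))%:E) ->
  ('E_P0[(fun t => W t * f (W t))%R] =
   'E_P0[(fun t => W t ^+ 2)%R] * 'E_P[(fun t => slope0 f (Wsq t))%R])%E.
Proof.
move=> W1 EW hsq mf iWf.
have W2slope t : W t ^+ 2 * slope0 f (W t) = W t * f (W t) - W t * f 0.
  have [->|Wt] := eqVneq (W t) 0; first by rewrite expr0n !mul0r subr0.
  by rewrite /slope0 expr2 -mulrA mulVKf// mulrBr.
have W2slopeE : (fun t => W t ^+ 2 * slope0 f (W t)) =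
    (fun t => W t * f (W t)) \- (fun t => W t * f 0) by apply/funext => t; rewrite W2slope.
have Wf1 : (fun t => W t * f (W t)) \in Lfun P0 1 by apply/Lfun1_integrable.
have fW1 : (fun t => W t * f 0) \in Lfun P0 1.
  exact: (Lfun_scale (f 0) (lexx 1) W1).
rewrite -hsq.
- rewrite W2slopeE expectationB// [X in (_ - X)%E](_ : _ = 0%E) ?sube0//.
  by rewrite (expectationZl (f 0) W1) EW mule0.
- exact: measurable_slope0.
- under eq_fun do rewrite W2slope EFinB.
  apply: integrableB => //.
  exact/Lfun1_integrable.
Qed.

Theorem proposition3p2 (R : realType) (n : nat) (hn : (0 < n)%N)
  (d0 : measure_display) (T0 : measurableType d0) (P0 : probability T0 R)
  (W : {RV P0 >-> R})
  (hW2 : (W : T0 -> R) \in Lfun P0 2%:E)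
  (hmean : ('E_P0[W] = 0)%E)
  (hvar : ('V_P0[W] != 0)%E)
  (d : measure_display) (T : measurableType d) (P : probability T R)
  (Wsq : {RV P >-> R}) (U : 'I_n -> {RV P >-> R})
  (hWsq : square_biased P0 W P Wsq)
  (hU : forall k : 'I_n, same_law (distribution P (U k)) (uniform_prob (@ltr01 R)))
  (hUind : mutually_independent P (fun (k : 'I_n) (t : T) => U k t))
  (hUW : independent2 P (fun t : T => [tuple U k t | k < n]) Wsq)
  (d1 : measure_display) (T1 : measurableType d1) (P1 : probability T1 R)
  (Wstar : {RV P1 >-> R})
  (hstar : eq_in_law P1 Wstar P (fun t : T => (\prod_(k < n) U k t) * Wsq t)) :
  zero_biased n P0 W P1 Wstar.
Proof.
move=> f df iWf iA.
have varE : ('V_P0[W] = 'E_P0[(fun t => W t ^+ 2)%R])%E.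
  rewrite varianceE// hmean expe2 mule0 sube0; congr ('E_P0[_])%E.
have W1 : (W : T0 -> R) \in Lfun P0 1.
  by apply: Lfun_subset12 => //; exact: fin_num_measure.
have Wsq0 : P (Wsq @^-1` [set 0]) = 0%E.
  by apply: square_biased_neq0 hWsq _; rewrite -varE.
have mf : measurable_fun setT f by apply: derivable_measurable_fun; exact: (df 0%N hn).
rewrite (square_biased_slope0 W1 hmean hWsq mf iWf) -varE; congr (_ * _)%E.
have nE : n = n.-1.+1 by rewrite prednK.
have kn : (n.-1 < n)%N by rewrite -nE.
have XnE : (fun t => (\prod_(k < n) U k t) * Wsq t) = partial_prod Wsq U n.
  by apply/funext => t; congr (_ * _); apply: eq_bigl => i; rewrite ltn_ord.
pose X : {RV P >-> R} :=
  HB.pack (partial_prod Wsq U n) (isMeasurableFun.Build _ _ _ _ _ (measurable_partial_prod Wsq U n)).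
have lawE (g : R -> \bar R) :
    (\int[distribution P1 Wstar]_x g x = \int[distribution P X]_x g x)%E.
  apply: eq_measure_integral => A mA _; have := hstar A mA; by rewrite XnE.
have mA : measurable_fun setT (fun x => (A_op n f x)%:E).
  apply/measurable_EFinP; apply: measurable_derive1 => x.
  exact: (derivable_iter_T_op df kn).
have iAX : P.-integrable setT (fun t => (A_op n f (X t))%:E).
  apply/integrableP; split; first exact: (measurableT_comp mA).
  have mabs : measurable_fun setT (fun x => `|(A_op n f x)%:E|%E) by exact: measurableT_comp.
  have := ge0_integral_distribution X mabs (fun=> abse_ge0 _) => /= <-.
  rewrite -lawE ge0_integral_distribution//.
  by case/integrableP: iA.
have := integral_derive1_iter_T_op hU hUind hUW Wsq0 df kn; rewrite -nE => /(_ iAX)[_].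
rewrite unlock => <-.
transitivity (\int[distribution P X]_x (A_op n f x)%:E)%E.
  by rewrite integral_distribution.
by rewrite -lawE integral_distribution.
Qed.
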